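(* Let $T$ be a (nondegenerate) triangle in the plane $\mathbb{R}^2$. Then $T$ has a unique taxicab incircle if and only if $T$ is an inscribed triangle.
   Context: The plane $\mathbb{R}^2$ carries the taxicab metric $d((x_1,y_1),(x_2,y_2)) = |x_1-x_2|+|y_1-y_2|$. A taxicab circle with center $c=(c_1,c_2)$ and radius $r>0$ is the set $\{p : d(p,c)=r\}$; it is a square with sides of slope $1$ and $-1$, and its four corners are $(c_1\pm r, c_2)$ and $(c_1, c_2\pm r)$. A taxicab incircle of a triangle is a taxicab circle that is entirely contained in the (closed) triangle and has three of its corners touching the three sides of the triangle, i.e. there are three distinct corners of the circle, one lying on each of the three sides (closed segments) of the triangle. The angle of a triangle at a vertex $V$ is the convex region bounded by the two rays from $V$ along the two sides meeting at $V$. A line through $V$ remains outside the angle if it does not meet the open interior of this region (it may contain one of the bounding rays). The angle is positively inscribed if the line of slope $1$ through its vertex remains outside the angle; negatively inscribed if the line of slope $-1$ through its vertex remains outside the angle; and inscribed if it is positively inscribed, negatively inscribed, or both. A triangle is inscribed if all three of its angles are inscribed. *)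

(* Defs.v *)
From HB Require Import structures.
From mathcomp Require Import all_boot all_order all_algebra.
From mathcomp Require Import all_classical all_reals all_analysis.
Import Order.TTheory GRing.Theory Num.Theory.
Import numFieldNormedType.Exports.

Set Implicit Arguments.
Unset Strict Implicit.
Unset Printing Implicit Defensive.

Local Open Scope classical_set_scope.
Local Open Scope ring_scope.

(* [R^o] rather than [R], so that scaling [t *: p] is available on points; the
   topology is the product topology. *)
Notation plane R := (R^o * R^o)%type.

Section TaxicabGeometry.
Context {R : realType}.
Implicit Types (A B C P Q V c d p q : plane R) (S : set (plane R)) (m r : R).

Definition taxicab_dist p q : R := `|p.1 - q.1| + `|p.2 - q.2|.

Definition taxicab_circle c r : set (plane R) :=
  [set p | taxicab_dist p c = r].

Definition corner c r : set (plane R) :=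
  [set p | [\/ p = (c.1 + r, c.2), p = (c.1 - r, c.2),
               p = (c.1, c.2 + r) | p = (c.1, c.2 - r)]].

Definition collinear A B C : Prop :=
  exists P d, d != 0 /\
    [set A; B; C] `<=` [set p | exists t : R, p = P + t *: d].

Definition side P Q : set (plane R) :=
  [set p | exists t : R, 0 <= t <= 1 /\ p = (1 - t) *: P + t *: Q].

Definition closed_triangle A B C : set (plane R) :=
  [set p | exists a b g : R, [/\ 0 <= a, 0 <= b, 0 <= g, a + b + g = 1 &
    p = a *: A + b *: B + g *: C]].

(* A circle is a set of points: it does not come with a chosen center and
   radius, and in "unique incircle" it is the set that is unique. *)
Definition taxicab_incircle A B C S : Prop :=
  exists c r, [/\ 0 < r, S = taxicab_circle c r, S `<=` closed_triangle A B C &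
    exists pA pB pC : plane R,
      [/\ corner c r pA, corner c r pB & corner c r pC] /\
      [/\ pA != pB, pB != pC & pC != pA] /\
      [/\ side B C pA, side C A pB & side A B pC]].

Definition angle_region V P Q : set (plane R) :=
  [set p | exists s t : R, [/\ 0 <= s, 0 <= t &
    p = V + s *: (P - V) + t *: (Q - V)]].

Definition line_of_slope m V : set (plane R) :=
  [set p | p.2 - V.2 = m * (p.1 - V.1)].

(* [_°] is the topological interior, so the line may contain a bounding ray. *)
Definition remains_outside_angle (L : set (plane R)) V P Q : Prop :=
  L `&` (angle_region V P Q)° = set0.

Definition positively_inscribed V P Q : Prop :=
  remains_outside_angle (line_of_slope 1 V) V P Q.

Definition negatively_inscribed V P Q : Prop :=
  remains_outside_angle (line_of_slope (-1) V) V P Q.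

Definition inscribed_angle V P Q : Prop :=
  positively_inscribed V P Q \/ negatively_inscribed V P Q.

Definition inscribed_triangle A B C : Prop :=
  [/\ inscribed_angle A B C, inscribed_angle B C A & inscribed_angle C A B].

End TaxicabGeometry.

(* Main.v *)
Require Import Defs.
From HB Require Import structures.
From mathcomp Require Import all_boot all_order all_algebra.
From mathcomp Require Import all_classical all_reals all_analysis.
From mathcomp Require Import ring lra.

(** The argument runs in barycentric coordinates.  The coordinate [bary A B C]
is the affine function equal to 1 at [A] and vanishing on the line [BC]; its
linear part is [dbary A B C].  The triangle is where the three coordinates are
nonnegative, and a side is where moreover one of them vanishes.

On a taxicab circle with center [c] and radius [r], the least value of an affine
function [f] is [f c - r * n], where [n] is the dual norm of its linear part;
among the corners, it is attained exactly at those pointing in a direction of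
steepest descent.  A circle inside the triangle that has a corner on each side
therefore satisfies [bary c = r * n] for each of the three coordinates.  Since
the coordinates of [c] add up to 1, these equations determine [r] and [c]
([inradius], [incenter]).  So uniqueness is automatic: there is one candidate,
it does lie in the triangle, and it is an incircle if and only if three distinct
corners can be chosen, each in a steepest descent direction for its side
([taxicab_incircleP]).

Both sides of the equivalence can now be read off from the derivatives
[(x, y)] of the three coordinates along the diagonals [(1, 1)] and [(1, -1)].
A corner direction amounts to a pair of signs, and it is steepest for a side
when these signs are weakly opposite to those of [x] and [y].  The angle at a
vertex is inscribed when the pairs of the two sides through it do not lie in the
same open quadrant, since a diagonal through the vertex enters the angle when
the two coordinates that vanish at the vertex both strictly increase, or both
strictly decrease, along it ([inscribed_angleP]).  That distinct corners exist
exactly when no two pairs share an open quadrant is a statement about three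
vectors of the plane with sum zero ([distinct_opposesP]). *)

Import Order.TTheory GRing.Theory Num.Theory.
Import numFieldNormedType.Exports.

Set Implicit Arguments.
Unset Strict Implicit.
Unset Printing Implicit Defensive.

Local Open Scope classical_set_scope.
Local Open Scope ring_scope.

(** * Sign patterns of zero-sum triples *)

Section Quadrants.
Context {R : realType}.
Implicit Types (x y : R) (q : bool * bool).

(** A sign is encoded by a boolean [b], as [(-1) ^+ b]; thus [q] names a closed
quadrant, and [opposes q x y] puts [(x, y)] in the quadrant opposite to it. *)
Definition opposes q x y : Prop :=
  (-1) ^+ q.1 * x <= 0 /\ (-1) ^+ q.2 * y <= 0.

Definition distinct_opposes x1 y1 x2 y2 x3 y3 : Prop :=
  exists q1 q2 q3, [/\ q1 != q2, q2 != q3 & q3 != q1] /\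
    [/\ opposes q1 x1 y1, opposes q2 x2 y2 & opposes q3 x3 y3].

Lemma distinct_opposes_rot x1 y1 x2 y2 x3 y3 :
  distinct_opposes x1 y1 x2 y2 x3 y3 -> distinct_opposes x2 y2 x3 y3 x1 y1.
Proof.
by move=> [q1 [q2 [q3 [[? ? ?] [? ? ?]]]]]; exists q2, q3, q1; split; split.
Qed.

Lemma opposes_sign x : exists b : bool, (-1) ^+ b * x <= 0.
Proof.
by case: (leP x 0) => x0; [exists false|exists true];
  rewrite ?expr0 ?expr1; lra.
Qed.

(** The first coordinates isolate the third vector from the first two, and the
second coordinates separate those. *)
Lemma distinct_opposes_pair x1 y1 x2 y2 x3 y3 :
  x1 + x2 + x3 = 0 -> 0 <= x1 * x2 -> y1 * y2 <= 0 ->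
  distinct_opposes x1 y1 x2 y2 x3 y3.
Proof.
move=> sx x12 y12.
have [b [b1 b2 b3]] : exists b : bool,
    [/\ (-1) ^+ b * x1 <= 0, (-1) ^+ b * x2 <= 0 & (-1) ^+ (~~ b) * x3 <= 0].
  case: (boolP ((0 <= x1) && (0 <= x2))) => [/andP[? ?]|].
    by exists true; rewrite /= ?expr0 ?expr1; split; lra.
  rewrite negb_and -!ltNge => /orP n12.
  have [? ?] : x1 <= 0 /\ x2 <= 0 by case: n12 => ?; split; nra.
  by exists false; rewrite /= ?expr0 ?expr1; split; lra.
have [a [a1 a2]] : exists a : bool,
    (-1) ^+ a * y1 <= 0 /\ (-1) ^+ (~~ a) * y2 <= 0.
  case: (boolP ((0 <= y1) && (y2 <= 0))) => [/andP[? ?]|].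
    by exists true; rewrite /= ?expr0 ?expr1; split; lra.
  rewrite negb_and -!ltNge => /orP n12.
  have [? ?] : y1 <= 0 /\ 0 <= y2 by case: n12 => ?; split; nra.
  by exists false; rewrite /= ?expr0 ?expr1; split; lra.
have [d d3] := opposes_sign y3.
exists (b, a), (b, ~~ a), (~~ b, d).
by split; [case: a b d {a1 a2 b1 b2 b3 d3} => [] [] []|split; split].
Qed.

Lemma opposes_inj q1 q2 x1 y1 x2 y2 : opposes q1 x1 y1 -> opposes q2 x2 y2 ->
  0 < x1 * x2 -> 0 < y1 * y2 -> q1 = q2.
Proof.
have sgn (b c : bool) (u v : R) :
    (-1) ^+ b * u <= 0 -> (-1) ^+ c * v <= 0 -> 0 < u * v -> b = c.
  by case: b c => [] [] //; rewrite ?expr0 ?expr1 => u0 v0 uv; exfalso; nra.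
case: q1 q2 => [a b] [c d] [/= x1a y1b] [/= x2c y2d] x12 y12.
by rewrite (sgn _ _ _ _ x1a x2c x12) (sgn _ _ _ _ y1b y2d y12).
Qed.

(** If the first two vectors have first coordinates of the same weak sign but
cannot be told apart by the second ones, then one of these first coordinates
vanishes, so that its vector may be grouped with the third one instead: the
second coordinate of the latter has the other sign, as the sum is zero. *)
Lemma distinct_opposes_mates x1 y1 x2 y2 x3 y3 :
  x1 + x2 + x3 = 0 -> y1 + y2 + y3 = 0 ->
  0 <= x1 * x2 -> x1 * x2 <= 0 \/ y1 * y2 <= 0 ->
  distinct_opposes x1 y1 x2 y2 x3 y3.
Proof.
move=> sx sy x12 h; case: (leP (y1 * y2) 0) => [y12|y12].
  exact: distinct_opposes_pair.
have : x1 * x2 == 0.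
  by case: h => h; [rewrite eq_le h|move: y12; rewrite ltNge h].
have y3E : y3 = - y1 - y2 by lra.
rewrite mulf_eq0 => /orP[/eqP x0|/eqP x0].
  apply: distinct_opposes_rot.
  by apply: distinct_opposes_pair; rewrite ?x0 ?mulr0 ?y3E //; [lra|nra].
do 2 apply: distinct_opposes_rot.
by apply: distinct_opposes_pair; rewrite ?x0 ?mul0r ?y3E //; [lra|nra].
Qed.

(** Two vectors in the same open quadrant are opposed by a single one.
Conversely, among three first coordinates two have the same weak sign. *)
Lemma distinct_opposesP x1 y1 x2 y2 x3 y3 :
  x1 + x2 + x3 = 0 -> y1 + y2 + y3 = 0 ->
  distinct_opposes x1 y1 x2 y2 x3 y3 <->
  [/\ x2 * x3 <= 0 \/ y2 * y3 <= 0, x3 * x1 <= 0 \/ y3 * y1 <= 0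
    & x1 * x2 <= 0 \/ y1 * y2 <= 0].
Proof.
move=> sx sy; split.
  move=> [q1 [q2 [q3 [[n12 n23 n31] [opp1 opp2 opp3]]]]].
  have apart q q' x y x' y' : q != q' -> opposes q x y -> opposes q' x' y' ->
      x * x' <= 0 \/ y * y' <= 0.
    move=> /eqP nq o o'.
    case: (leP (x * x') 0) => [|xx]; first by left.
    case: (leP (y * y') 0) => [|yy]; first by right.
    by case: nq; exact: opposes_inj o o' xx yy.
  split; [exact: apart n23 opp2 opp3|exact: apart n31 opp3 opp1|].
  exact: apart n12 opp1 opp2.
move=> [h23 h31 h12].
case: (leP 0 (x1 * x2)) => [x12|x12]; first exact: distinct_opposes_mates.
case: (leP 0 (x2 * x3)) => [x23|x23].
  by do 2 apply: distinct_opposes_rot; apply: distinct_opposes_mates => //; lra.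
apply: distinct_opposes_rot; apply: distinct_opposes_mates => //; [lra|lra|].
nra.
Qed.

End Quadrants.

(** * Barycentric coordinates *)

Section Barycentric.
Context {R : realType}.
Implicit Types (A B C p q v : plane R) (x a b g : R).

(** Points have coordinates in [R^o]; stated in [R], the operations on them
become those of the field, on which [ring] and [field] work. *)
Lemma coordE :
  (forall p q, ((p + q).1 = (p.1 : R) + q.1 :> R) *
               ((p + q).2 = (p.2 : R) + q.2 :> R)) *
  (forall x p, ((x *: p).1 = x * p.1 :> R) * ((x *: p).2 = x * p.2 :> R)).
Proof. by []. Qed.

(** Twice the signed area. *)
Definition area2 A B C : R :=
  (B.1 - A.1) * (C.2 - A.2) - (B.2 - A.2) * (C.1 - A.1).

Definition bary A B C p : R := area2 p B C / area2 A B C.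

(** The linear part of [bary A B C], see [bary_line]. *)
Definition dbary A B C v : R :=
  (v.1 * (B.2 - C.2) - v.2 * (B.1 - C.1)) / area2 A B C.

Lemma area2_rot A B C : area2 B C A = area2 A B C.
Proof. by rewrite /area2; ring. Qed.

Lemma bary_line A B C p x v :
  bary A B C (p + x *: v) = bary A B C p + x * dbary A B C v.
Proof.
rewrite /bary /dbary mulrA -mulrDl; congr (_ / _).
by rewrite /area2 !coordE; ring.
Qed.

Lemma dbary_sum A B C v :
  dbary A B C v + dbary B C A v + dbary C A B v = 0.
Proof.
rewrite /dbary (area2_rot A B C) -(area2_rot C A B) -!mulrDl.
by rewrite (_ : _ + _ = 0) ?mul0r //; ring.
Qed.

Section NonDegenerate.
Variables A B C : plane R.
Hypothesis D0 : area2 A B C != 0.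

Lemma bary_comb a b g : a + b + g = 1 ->
  bary A B C (a *: A + b *: B + g *: C) = a.
Proof.
move=> /eqP; rewrite -addrA eq_sym -subr_eq => /eqP <-.
by apply: (canLR (mulfK D0)); rewrite /area2 !coordE; ring.
Qed.

Lemma bary_sum p : bary A B C p + bary B C A p + bary C A B p = 1.
Proof.
rewrite /bary (area2_rot A B C) -(area2_rot C A B) -!mulrDl.
by apply: (canLR (mulfK D0)); rewrite /area2; ring.
Qed.

Lemma bary_expand p :
  p = bary A B C p *: A + bary B C A p *: B + bary C A B p *: C.
Proof.
rewrite /bary (area2_rot A B C) -(area2_rot C A B).
rewrite [LHS]surjective_pairing [RHS]surjective_pairing !coordE; congr (_, _).
  by move: D0; rewrite /area2 => D1; field.
by move: D0; rewrite /area2 => D1; field.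
Qed.

Lemma bary_eq p q : bary A B C p = bary A B C q ->
  bary B C A p = bary B C A q -> bary C A B p = bary C A B q -> p = q.
Proof. by move=> a b c; rewrite (bary_expand p) a b c -bary_expand. Qed.

End NonDegenerate.

Lemma bary_comb3 A B C a b g : area2 A B C != 0 -> a + b + g = 1 ->
  [/\ bary A B C (a *: A + b *: B + g *: C) = a,
      bary B C A (a *: A + b *: B + g *: C) = b
    & bary C A B (a *: A + b *: B + g *: C) = g].
Proof.
move=> D abg; split; first exact: bary_comb.
  have -> : a *: A + b *: B + g *: C = b *: B + g *: C + a *: A.
    by rewrite -addrA addrC.
  apply: bary_comb; first by rewrite area2_rot.
  by lra.
have -> : a *: A + b *: B + g *: C = g *: C + a *: A + b *: B.
  by rewrite addrC addrA.
apply: bary_comb; first by rewrite -area2_rot.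
by lra.
Qed.

Lemma closed_triangleP A B C p : area2 A B C != 0 -> closed_triangle A B C p <->
  [/\ 0 <= bary A B C p, 0 <= bary B C A p & 0 <= bary C A B p].
Proof.
move=> D; split=> [[a [b [g [a0 b0 g0 abg ->]]]]|[a0 b0 g0]].
  by have [-> -> ->] := bary_comb3 D abg.
exists (bary A B C p), (bary B C A p), (bary C A B p).
by split; rewrite ?bary_sum -?bary_expand.
Qed.

Lemma closed_triangle_rot A B C : closed_triangle A B C = closed_triangle B C A.
Proof.
apply/seteqP; split=> p [a [b [g [? ? ? abg ->]]]].
  by exists b, g, a; split; rewrite // -?addrA ?(addrC (a *: A)) ?addrA //; lra.
by exists g, a, b; split => //; [lra|rewrite addrC addrA].
Qed.

Lemma sideP A B C p : area2 A B C != 0 ->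
  side B C p <-> closed_triangle A B C p /\ bary A B C p = 0.
Proof.
move=> D; split=> [[t [t01 ->]]|[/(closed_triangleP p D)[_ b0 g0] a0]].
  split.
    exists 0, (1 - t), t; split; rewrite ?scale0r ?add0r //; lra.
  by rewrite -[(1 - t) *: B]add0r -(scale0r A) bary_comb//; lra.
have s := bary_sum D p; exists (bary C A B p); split; first lra.
rewrite {1}(bary_expand D p) a0 scale0r add0r.
by congr (_ *: _ + _); lra.
Qed.

Lemma collinear_area2 A B C : area2 A B C = 0 -> collinear A B C.
Proof.
have colin (v d : plane R) : d != 0 -> v.1 * d.2 = v.2 * d.1 ->
    exists t : R, v = t *: d.
  (* The coefficient of the orthogonal projection of [v] on [d]. *)
  move=> d0 vd; exists ((v.1 * d.1 + v.2 * d.2) / (d.1 ^+ 2 + d.2 ^+ 2)).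
  have dd : (d.1 : R) ^+ 2 + (d.2 : R) ^+ 2 != 0.
    apply: contra d0; rewrite paddr_eq0 ?sqr_ge0// !sqrf_eq0.
    by move=> /andP[/eqP d1 /eqP d2]; rewrite [d]surjective_pairing d1 d2.
  rewrite [LHS]surjective_pairing [RHS]surjective_pairing !coordE; congr (_, _);
    rewrite mulrAC; apply: (canRL (mulfK dd)).
    have e : d.2 * (v.1 * d.2) = d.2 * (v.2 * d.1) :> R by rewrite vd.
    by lra.
  have e : d.1 * (v.1 * d.2) = d.1 * (v.2 * d.1) :> R by rewrite vd.
  by lra.
move=> D; have [AB|AB] := eqVneq B A.
  have [AC|AC] := eqVneq C A.
    exists A, (1, 0); split; first by rewrite xpair_eqE oner_eq0.
    by move=> p [[->|->]|->]; exists 0; rewrite scale0r addr0 ?AB ?AC.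
  exists A, (C - A); rewrite subr_eq0; split=> // p.
  by move=> [[->|->]|->]; [exists 0|exists 0|exists 1];
    rewrite ?AB ?scale0r ?scale1r ?addr0// addrC subrK.
have [||t Ct] := colin (C - A) (B - A); first by rewrite subr_eq0.
  by move: D; rewrite /area2 /= => D; lra.
exists A, (B - A); rewrite subr_eq0; split=> // p.
move=> [[->|->]|->]; [exists 0|exists 1|exists t];
  by rewrite -?Ct ?scale0r ?scale1r ?addr0// addrC subrK.
Qed.

Lemma dbary_bary A B C p q :
  dbary A B C (q - p) = bary A B C q - bary A B C p.
Proof.
have qE : q = p + 1 *: (q - p) by rewrite scale1r addrC subrK.
by rewrite {2}qE bary_line; ring.
Qed.

Lemma bary_vertices A B C : area2 A B C != 0 ->
  [/\ bary A B C A = 1, bary A B C B = 0 & bary A B C C = 0].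
Proof.
move=> D; rewrite /bary divff //; split=> //;
  by rewrite /area2 (_ : _ - _ = 0) ?mul0r//; ring.
Qed.

End Barycentric.

(** * Inscribed angles *)

Section InscribedAngles.
Context {R : realType}.
Implicit Types (A B C p v : plane R).

Lemma angle_regionP A B C p : area2 A B C != 0 -> angle_region A B C p <->
  0 <= bary B C A p /\ 0 <= bary C A B p.
Proof.
move=> D.
have regE s t : A + s *: (B - A) + t *: (C - A) =
    (1 - s - t) *: A + s *: B + t *: C.
  rewrite [LHS]surjective_pairing [RHS]surjective_pairing !coordE /=.
  by congr (_, _); ring.
split=> [[s [t [s0 t0 ->]]]|[s0 t0]].
  rewrite regE; have [||_ -> ->] := @bary_comb3 _ A B C (1 - s - t) s t => //.
  by lra.
exists (bary B C A p), (bary C A B p); split=> //.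
rewrite regE {1}(bary_expand D p); congr (_ *: _ + _ + _).
by have := bary_sum D p; lra.
Qed.

Lemma nbhs_line p v (S : set (plane R)) : nbhs p S ->
  exists2 x, 0 < x & S (p + x *: v).
Proof.
move=> Sp.
have cf : (fun x : R => p + x *: v) @ 0^'+ --> p.
  rewrite -[X in _ --> X]addr0 -(scale0r v).
  apply: cvgD; first exact: cvg_cst.
  apply: cvgZr_tmp; exact: cvg_at_right_filter.
have [x [x0 Sx]] : exists x, 0 < x /\ S (p + x *: v).
  apply: (@filter_ex _ (0 : R)^'+); apply: filterI; last exact: cf.
  exact: nbhs_right_gt.
by exists x.
Qed.

Lemma continuous_bary A B C : continuous (bary A B C : plane R -> R^o).
Proof.
move=> p; rewrite /bary /area2.
apply: cvgM; last exact: cvg_cst.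
by apply: cvgB; apply: cvgM; apply: cvgB;
  (exact: cvg_cst || exact: cvg_fst || exact: cvg_snd).
Qed.

(** From an interior point one can still move a little in the directions
[A - B] and [A - C], along each of which one of the coordinates decreases at
unit speed. *)
Lemma interior_angle_regionP A B C p : area2 A B C != 0 ->
  (angle_region A B C)° p <-> 0 < bary B C A p /\ 0 < bary C A B p.
Proof.
move=> D.
have [|b1 _ b3] := @bary_vertices _ B C A; first by rewrite area2_rot.
have [|c1 c2 _] := @bary_vertices _ C A B; first by rewrite -area2_rot.
split=> [pI|[pB pC]].
  have [x x0] := nbhs_line (A - B) pI; have [y y0] := nbhs_line (A - C) pI.
  move=> /(angle_regionP _ D)[_ +] /(angle_regionP _ D)[+ _].
  rewrite !bary_line !dbary_bary b1 b3 c1 c2.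
  by split; lra.
suff : \forall z \near p, 0 < bary B C A z /\ 0 < bary C A B z.
  by apply: filterS => z [? ?]; apply/(angle_regionP _ D); split; exact: ltW.
by apply: filterI; exact: (cvgr_gt _ (@continuous_bary _ _ _ p)).
Qed.

(** The line is parametrized by [A + x *: (1, m)], where both coordinates are
linear in [x], so they are positive together for some [x] exactly when their
slopes have the same strict sign. *)
Lemma remains_outside_angleP m A B C : area2 A B C != 0 ->
  remains_outside_angle (line_of_slope m A) A B C <->
  dbary B C A (1, m) * dbary C A B (1, m) <= 0.
Proof.
move=> D.
have [|_ _ b3] := @bary_vertices _ B C A; first by rewrite area2_rot.
have [|_ c2 _] := @bary_vertices _ C A B; first by rewrite -area2_rot.
split=> [out|le0].
  rewrite leNgt; apply/negP => gt0.
  have [x [xB xC]] : exists x,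
      0 < x * dbary B C A (1, m) /\ 0 < x * dbary C A B (1, m).
    exists (dbary B C A (1, m)); split=> //.
    rewrite -expr2 lt0r sqr_ge0 andbT sqrf_eq0.
    by apply: contraTneq gt0 => ->; rewrite mul0r ltxx.
  suff : set0 (A + x *: (1, m)) by [].
  rewrite -out; split; first by rewrite /line_of_slope /= /GRing.scale /=; ring.
  by apply/(interior_angle_regionP _ D); rewrite !bary_line b3 c2 !add0r.
apply/seteqP; split=> // p [] pl /(interior_angle_regionP _ D) [].
have -> : p = A + (p.1 - A.1) *: (1, m).
  rewrite [LHS]surjective_pairing [RHS]surjective_pairing /= /GRing.scale /=.
  by rewrite mulr1 [_ * m]mulrC -pl !(addrC A.1) !(addrC A.2) !subrK.
rewrite !bary_line b3 c2 !add0r => xB xC.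
have := mulr_gt0 xB xC; rewrite mulrACA -expr2 ltNge.
by rewrite mulr_ge0_le0 // sqr_ge0.
Qed.

Lemma inscribed_angleP A B C : area2 A B C != 0 -> inscribed_angle A B C <->
  dbary B C A (1, 1) * dbary C A B (1, 1) <= 0 \/
  dbary B C A (1, -1) * dbary C A B (1, -1) <= 0.
Proof. by move=> D; rewrite -!remains_outside_angleP. Qed.

End InscribedAngles.

(** * The only possible incircle *)

Section Incircle.
Context {R : realType}.
Implicit Types (A B C c p v : plane R) (r x : R) (q : bool * bool).

(** The signs [q] are those of the components of the direction along the
diagonals, its inner products with [(1, 1)] and [(1, -1)]. *)
Definition corner_dir q : plane R :=
  (((-1) ^+ q.1 + (-1) ^+ q.2) / 2, ((-1) ^+ q.1 - (-1) ^+ q.2) / 2).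

Lemma cornerP c r p : corner c r p <-> exists q, p = c + r *: corner_dir q.
Proof.
have E q : c + r *: corner_dir q = match q with
    | (false, false) => (c.1 + r, c.2) | (true, true) => (c.1 - r, c.2)
    | (false, true) => (c.1, c.2 + r) | (true, false) => (c.1, c.2 - r) end.
  rewrite [LHS]surjective_pairing /= /GRing.scale /=.
  by case: q => [] [] [] /=; rewrite ?expr0 ?expr1; congr (_, _); field.
split=> [[->|->|->|->]|[q ->]].
- by exists (false, false); rewrite E.
- by exists (true, true); rewrite E.
- by exists (false, true); rewrite E.
- by exists (true, false); rewrite E.
rewrite E; case: q => [] [] [].
- exact: Or42.
- exact: Or44.
- exact: Or43.
- exact: Or41.
Qed.

Lemma corner_dir_inj : injective corner_dir.
Proof.
move=> [a b] [c d] [/= e1 e2].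
have sgn_inj (u v : bool) : (-1) ^+ u = (-1) ^+ v :> R -> u = v.
  by case: u v => [] [] //; rewrite expr0 expr1 => ?; exfalso; lra.
by congr (_, _); apply: sgn_inj; lra.
Qed.

Lemma corner_on_circle c r q : 0 < r ->
  taxicab_circle c r (c + r *: corner_dir q).
Proof.
move=> r0; have /cornerP : exists q',
    c + r *: corner_dir q = c + r *: corner_dir q'.
  by exists q.
move: (c + _) => p; rewrite /taxicab_circle /taxicab_dist /= => -[] -> /=.
- by rewrite addrAC !subrr add0r normr0 addr0 gtr0_norm.
- by rewrite addrAC !subrr add0r normr0 addr0 normrN gtr0_norm.
- by rewrite addrAC !subrr add0r normr0 add0r gtr0_norm.
- by rewrite addrAC !subrr add0r normr0 add0r normrN gtr0_norm.
Qed.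

(** The dual of the taxicab norm, evaluated at the linear form [dbary A B C]:
the maximum of the form over the corner directions.  These are the half sums
of one of the vectors [(1, 1)], [(-1, -1)] and one of [(1, -1)], [(-1, 1)],
whence the formula. *)
Definition dbary_norm A B C : R :=
  (`|dbary A B C (1, 1)| + `|dbary A B C (1, -1)|) / 2.

Lemma dbaryE A B C v : dbary A B C v =
  ((v.1 + v.2) * dbary A B C (1, 1) + (v.1 - v.2) * dbary A B C (1, -1)) / 2.
Proof. by rewrite /dbary /=; set i := (area2 _ _ _)^-1; field. Qed.

Lemma dbary_norm_bound A B C v :
  `|dbary A B C v| <= (`|v.1| + `|v.2|) * dbary_norm A B C.
Proof.
have -> : dbary A B C v = (v.1 + v.2) * (dbary A B C (1, 1) / 2) +
    (v.1 - v.2) * (dbary A B C (1, -1) / 2) by rewrite dbaryE; field.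
rewrite /dbary_norm (mulrDl _ _ 2^-1) mulrDr (le_trans (ler_normD _ _))//.
rewrite !normrM (@ger0_norm _ 2^-1) ?invr_ge0//.
by rewrite lerD// ler_wpM2r ?mulr_ge0 ?invr_ge0// ?ler_normD//
  -(normrN v.2) ler_normD.
Qed.

Lemma dbary_norm_gt0 A B C : area2 A B C != 0 -> 0 < dbary_norm A B C.
Proof.
move=> D; have : dbary A B C (A - B) = 1.
  by rewrite /dbary; apply: (canLR (mulfK D)); rewrite /area2 /=; ring.
have := dbary_norm_bound A B C (A - B) => /[swap] ->; rewrite normr1 => bound.
rewrite ltNge; apply/negP => le0.
by move: bound; rewrite leNgt (le_lt_trans _ ltr01) // mulr_ge0_le0 // addr_ge0.
Qed.

Lemma dbary_corner_dir A B C q : dbary A B C (corner_dir q) =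
  ((-1) ^+ q.1 * dbary A B C (1, 1) + (-1) ^+ q.2 * dbary A B C (1, -1)) / 2.
Proof. by rewrite dbaryE /corner_dir /=; field. Qed.

Lemma sign_ge (b : bool) x : - `|x| <= (-1) ^+ b * x.
Proof.
rewrite lerNl -mulNr ler_normr.
by case: b; rewrite ?expr0 ?expr1; apply/orP; [left|right]; lra.
Qed.

Lemma sign_le0 (b : bool) x : (-1) ^+ b * x <= 0 <-> (-1) ^+ b * x = - `|x|.
Proof.
split=> [/ler0_norm|->]; last by rewrite oppr_le0.
by rewrite normrMsign => ->; rewrite opprK.
Qed.

Lemma opposesP A B C q :
  opposes q (dbary A B C (1, 1)) (dbary A B C (1, -1)) <->
  dbary A B C (corner_dir q) = - dbary_norm A B C.
Proof.
rewrite /opposes !sign_le0 dbary_corner_dir /dbary_norm.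
have := sign_ge q.1 (dbary A B C (1, 1)).
have := sign_ge q.2 (dbary A B C (1, -1)).
by move=> ? ?; split=> [[-> ->]|?]; [lra|split; lra].
Qed.

Lemma dbary_corner_dir_ge A B C q :
  - dbary_norm A B C <= dbary A B C (corner_dir q).
Proof.
rewrite dbary_corner_dir /dbary_norm.
have := sign_ge q.1 (dbary A B C (1, 1)).
have := sign_ge q.2 (dbary A B C (1, -1)).
lra.
Qed.

(** A corner in a steepest descent direction is in the triangle, which bounds
[bary A B C c] from below; the corner on the side [BC] shows that the bound is
reached, and that this corner too points in such a direction. *)
Lemma incircle_side_contact A B C c r q : area2 A B C != 0 -> 0 < r ->
  taxicab_circle c r `<=` closed_triangle A B C ->
  side B C (c + r *: corner_dir q) ->
  bary A B C c = r * dbary_norm A B C /\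
  opposes q (dbary A B C (1, 1)) (dbary A B C (1, -1)).
Proof.
move=> D r0 sub /(sideP _ D)[_]; rewrite bary_line => touch.
have [b0 hb0] := opposes_sign (dbary A B C (1, 1)).
have [b1 hb1] := opposes_sign (dbary A B C (1, -1)).
have /opposesP steepest :
    opposes (b0, b1) (dbary A B C (1, 1)) (dbary A B C (1, -1)) by [].
have /sub/(closed_triangleP _ D)[+ _ _] := corner_on_circle c (b0, b1) r0.
rewrite bary_line steepest => inside.
have bound := dbary_corner_dir_ge A B C q.
have h : r * dbary A B C (corner_dir q) <= r * - dbary_norm A B C by lra.
rewrite ler_pM2l // in h.
have e : dbary A B C (corner_dir q) = - dbary_norm A B C.
  by apply/eqP; rewrite eq_le h bound.
by split; [move: touch; rewrite e; lra | apply/opposesP].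
Qed.

(** The solution of [bary c = r * dbary_norm] for the three coordinates, which
have sum 1. *)
Definition inradius A B C : R :=
  (dbary_norm A B C + dbary_norm B C A + dbary_norm C A B)^-1.

Definition incenter A B C : plane R :=
  (inradius A B C * dbary_norm A B C) *: A
  + (inradius A B C * dbary_norm B C A) *: B
  + (inradius A B C * dbary_norm C A B) *: C.

Lemma taxicab_incircleP A B C S : area2 A B C != 0 ->
  taxicab_incircle A B C S <->
  S = taxicab_circle (incenter A B C) (inradius A B C) /\
  distinct_opposes (dbary A B C (1, 1)) (dbary A B C (1, -1))
    (dbary B C A (1, 1)) (dbary B C A (1, -1))
    (dbary C A B (1, 1)) (dbary C A B (1, -1)).
Proof.
move=> D.
have DB : area2 B C A != 0 by rewrite area2_rot.
have DC : area2 C A B != 0 by rewrite area2_rot.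
have h0 : 0 < dbary_norm A B C + dbary_norm B C A + dbary_norm C A B.
  by rewrite !addr_gt0 ?dbary_norm_gt0.
have r0 : 0 < inradius A B C by rewrite invr_gt0.
have [|cA cB cC] := @bary_comb3 _ A B C (inradius A B C * dbary_norm A B C)
    (inradius A B C * dbary_norm B C A) (inradius A B C * dbary_norm C A B) D.
  by rewrite -!mulrDr mulVf // gt_eqF.
rewrite -/(incenter A B C) in cA cB cC.
split=> [[c [r [r_gt0 -> sub]]]|].
  move=> [_ [_ [_ [[/cornerP[q1 ->] /cornerP[q2 ->] /cornerP[q3 ->]]]]]].
  move=> [[n12 n23 n31] [/(incircle_side_contact D r_gt0 sub)[e1 o1]]].
  rewrite closed_triangle_rot in sub.
  move=> /(incircle_side_contact DB r_gt0 sub)[e2 o2].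
  rewrite closed_triangle_rot in sub.
  move=> /(incircle_side_contact DC r_gt0 sub)[e3 o3].
  have rE : r = inradius A B C.
    have := bary_sum D c; rewrite e1 e2 e3 -!mulrDr => e.
    by apply: (mulIf (lt0r_neq0 h0)); rewrite mulVf // lt0r_neq0.
  have -> : c = incenter A B C by apply: (bary_eq D); rewrite ?cA ?cB ?cC -rE.
  rewrite rE; split=> //; exists q1, q2, q3; split=> //; split.
  - by apply: contraNneq n12 => ->.
  - by apply: contraNneq n23 => ->.
  - by apply: contraNneq n31 => ->.
move=> [-> [q1 [q2 [q3 [[n12 n23 n31] [opp1 opp2 opp3]]]]]].
exists (incenter A B C), (inradius A B C).
have sub : taxicab_circle (incenter A B C) (inradius A B C)
    `<=` closed_triangle A B C.
  move=> p pc; apply/(closed_triangleP p D).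
  have -> : p = incenter A B C + 1 *: (p - incenter A B C).
    by rewrite scale1r addrC subrK.
  have in_ge0 A' B' C' :
      bary A' B' C' (incenter A B C) = inradius A B C * dbary_norm A' B' C' ->
      0 <= bary A' B' C' (incenter A B C + 1 *: (p - incenter A B C)).
    move=> e; rewrite bary_line mul1r e.
    have := dbary_norm_bound A' B' C' (p - incenter A B C).
    rewrite [X in X * _](_ : _ = inradius A B C)//.
    by rewrite ler_norml => /andP[+ _]; lra.
  by split; exact: in_ge0.
split=> //.
exists (incenter A B C + inradius A B C *: corner_dir q1),
  (incenter A B C + inradius A B C *: corner_dir q2),
  (incenter A B C + inradius A B C *: corner_dir q3).
have distinct q q' : q != q' ->
    incenter A B C + inradius A B C *: corner_dir q !=
    incenter A B C + inradius A B C *: corner_dir q'.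
  by apply: contraNneq => /addrI/(scalerI (lt0r_neq0 r0))/corner_dir_inj ->.
have corn q : corner (incenter A B C) (inradius A B C)
    (incenter A B C + inradius A B C *: corner_dir q).
  by apply/cornerP; exists q.
split; first by split; exact: corn.
split; first by split; exact: distinct.
have touch A' B' C' q : area2 A' B' C' != 0 ->
    closed_triangle A B C = closed_triangle A' B' C' ->
    bary A' B' C' (incenter A B C) = inradius A B C * dbary_norm A' B' C' ->
    opposes q (dbary A' B' C' (1, 1)) (dbary A' B' C' (1, -1)) ->
    side B' C' (incenter A B C + inradius A B C *: corner_dir q).
  move=> D' T e /opposesP o; apply/(sideP _ D'); split.
    by rewrite -T; apply: sub; exact: corner_on_circle.
  by rewrite bary_line e o; lra.
split; [exact: touch opp1|apply: touch opp2|apply: touch opp3] => //.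
  by rewrite closed_triangle_rot.
by rewrite -closed_triangle_rot.
Qed.

End Incircle.

(** * The equivalence *)

Theorem theorem5p2 (R : realType) (A B C : plane R) (hT : ~ collinear A B C) :
  (exists! S : set (plane R), taxicab_incircle A B C S) <->
  inscribed_triangle A B C.
Proof.
have D : area2 A B C != 0.
  by apply/eqP => D0; apply: hT; exact: collinear_area2.
have DB : area2 B C A != 0 by rewrite area2_rot.
have DC : area2 C A B != 0 by rewrite -area2_rot.
have oppE := distinct_opposesP (dbary_sum A B C (1, 1))
  (dbary_sum A B C (1, -1)).
split=> [[S [/(taxicab_incircleP _ D)[_ /oppE[a b c]] _]]|[a b c]].
  by split; exact/inscribed_angleP.
exists (taxicab_circle (incenter A B C) (inradius A B C)).
split=> [|S /(taxicab_incircleP _ D)[-> _] //].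
apply/(taxicab_incircleP _ D); split=> //; apply/oppE.
by split; exact/inscribed_angleP.
Qed.
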